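(* Let $(V,\mu,\nu)$ be an $IF$-normed space, let $p=(p_j)_{j\ge 0}$ and $q=(q_k)_{k\ge 0}$ belong to $SVA_+$, let $(x_{mn})_{m,n\ge 0}$ be a double sequence in $V$, let $x\in V$, and assume that $(x_{mn})$ is $(\bar N,p,q;1,1)$ summable to $x$. Then $x_{mn}\to x$ in $(V,\mu,\nu)$ if and only if for all $t>0$ $$\sup_{\lambda>1}\liminf_{m,n\to\infty}\mu\left(\frac{1}{(P_{\lambda_m}-P_m)(Q_{\lambda_n}-Q_n)}\sum_{j=m+1}^{\lambda_m}\sum_{k=n+1}^{\lambda_n}p_jq_k(x_{jk}-x_{mn}),t\right)=1$$ and $$\inf_{\lambda>1}\limsup_{m,n\to\infty}\nu\left(\frac{1}{(P_{\lambda_m}-P_m)(Q_{\lambda_n}-Q_n)}\sum_{j=m+1}^{\lambda_m}\sum_{k=n+1}^{\lambda_n}p_jq_k(x_{jk}-x_{mn}),t\right)=0.$$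
   Context: An $IF$-normed space $(V,\mu,\nu)$ is a real vector space $V$ with zero vector $\theta$ together with functions (fuzzy sets) $\mu,\nu:V\times\mathbb{R}\to[0,1]$ such that for all $x,y\in V$ and $t,s\in\mathbb{R}$: (a) $\mu(x,t)=0$ for $t\le 0$; (b) $\mu(x,t)=1$ for all $t>0$ if and only if $x=\theta$; (c) $\mu(cx,t)=\mu(x,t/|c|)$ for all $t>0$ and real $c\neq 0$; (d) $\mu(x+y,t+s)\ge\min\{\mu(x,t),\mu(y,s)\}$; (e) $\lim_{t\to\infty}\mu(x,t)=1$, and $\lim_{t\to 0}\mu(x,t)=0$ if $x\ne\theta$; (f) $\nu(x,t)=1$ for $t\le 0$; (g) $\nu(x,t)=0$ for all $t>0$ if and only if $x=\theta$; (h) $\nu(cx,t)=\nu(x,t/|c|)$ for all $t>0$ and real $c\ne 0$; (i) $\nu(x+y,t+s)\le\max\{\nu(x,t),\nu(y,s)\}$; (j) $\lim_{t\to\infty}\nu(x,t)=0$, and $\lim_{t\to 0}\nu(x,t)=1$ if $x\ne\theta$. A double sequence $(x_{mn})$ in $V$ converges to $x\in V$, written $x_{mn}\to x$, if for each $t>0$ and $\varepsilon\in(0,1)$ there is $n_0\in\mathbb{N}$ with $\mu(x_{mn}-x,t)>1-\varepsilon$ and $\nu(x_{mn}-x,t)<\varepsilon$ for all $m,n\ge n_0$. Limits of real double sequences are in Pringsheim's sense: $\liminf_{m,n\to\infty}a_{mn}=\lim_{N\to\infty}\inf_{m,n\ge N}a_{mn}$, and similarly for $\limsup$ (terms need only be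 defined for large $m,n$). Weights $p=(p_j)_{j\ge0}$, $q=(q_k)_{k\ge0}$ are sequences of nonnegative reals with $p_0,q_0>0$, $P_m=\sum_{j=0}^m p_j\to\infty$ and $Q_n=\sum_{k=0}^n q_k\to\infty$. Put $t^{11}_{mn}=\frac{1}{P_mQ_n}\sum_{j=0}^m\sum_{k=0}^n p_jq_kx_{jk}$. The double sequence $(x_{mn})$ is $(\bar N,p,q;1,1)$ summable to $x$ if $t^{11}_{mn}\to x$. For $\lambda>0$, $\lambda_m=[\lambda m]$ is the integer part of $\lambda m$ (likewise $\lambda_n=[\lambda n]$). $SVA_+$ is the set of nonnegative sequences $p=(p_j)$ with $p_0>0$ such that $\liminf_{m\to\infty}\left|\frac{P_{\lambda_m}}{P_m}-1\right|>0$ for all $\lambda>0$ with $\lambda\ne1$. *)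

(* Defs.v *)
(* MathComp-Analysis, over an arbitrary realType R. *)
From HB Require Import structures.
From mathcomp Require Import all_boot all_order all_algebra.
From mathcomp Require Import all_classical all_reals all_analysis.

Set Implicit Arguments.
Unset Strict Implicit.
Unset Printing Implicit Defensive.

Import Order.TTheory GRing.Theory Num.Theory.
Import numFieldNormedType.Exports.

Local Open Scope classical_set_scope.
Local Open Scope ring_scope.

(* [0^'] is the punctured neighbourhood filter: the limits at 0 are two-sided
   and ignore the value at 0. *)
Record IF_norm (R : realType) (V : lmodType R) (mu nu : V -> R -> R) : Prop :=
  IFNorm {
    mu_range : forall x t, 0 <= mu x t <= 1;
    nu_range : forall x t, 0 <= nu x t <= 1;
    mu_le0 : forall x t, t <= 0 -> mu x t = 0;
    mu_eq1 : forall x, (forall t, 0 < t -> mu x t = 1) <-> x = 0;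
    mu_scale : forall x t c, 0 < t -> c != 0 -> mu (c *: x) t = mu x (t / `|c|);
    mu_add : forall x y t s, Num.min (mu x t) (mu y s) <= mu (x + y) (t + s);
    mu_pinfty : forall x, mu x t @[t --> +oo] --> (1 : R);
    mu_zero : forall x, x <> 0 -> mu x t @[t --> 0^'] --> (0 : R);
    nu_le0 : forall x t, t <= 0 -> nu x t = 1;
    nu_eq0 : forall x, (forall t, 0 < t -> nu x t = 0) <-> x = 0;
    nu_scale : forall x t c, 0 < t -> c != 0 -> nu (c *: x) t = nu x (t / `|c|);
    nu_add : forall x y t s, nu (x + y) (t + s) <= Num.max (nu x t) (nu y s);
    nu_pinfty : forall x, nu x t @[t --> +oo] --> (0 : R);
    nu_zero : forall x, x <> 0 -> nu x t @[t --> 0^'] --> (1 : R)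
  }.

Definition IF_dcvg (R : realType) (V : lmodType R) (mu nu : V -> R -> R)
    (x : nat -> nat -> V) (l : V) : Prop :=
  forall t e : R, 0 < t -> 0 < e < 1 ->
    exists n0 : nat, forall m n : nat, (n0 <= m)%N -> (n0 <= n)%N ->
      1 - e < mu (x m n - l) t /\ nu (x m n - l) t < e.

(* Pringsheim lower and upper limits, taken in the extended reals so that the
   infima and suprema always exist. *)
Definition dlim_inf (R : realType) (a : nat -> nat -> R) : \bar R :=
  limn (fun N : nat => ereal_inf
    [set (a mn.1 mn.2)%:E | mn in [set mn | (N <= mn.1)%N /\ (N <= mn.2)%N]]).

Definition dlim_sup (R : realType) (a : nat -> nat -> R) : \bar R :=
  limn (fun N : nat => ereal_sup
    [set (a mn.1 mn.2)%:E | mn in [set mn | (N <= mn.1)%N /\ (N <= mn.2)%N]]).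

Definition psum (R : realType) (p : nat -> R) (m : nat) : R :=
  \sum_(0 <= j < m.+1) p j.

Definition weights (R : realType) (p : nat -> R) : Prop :=
  [/\ forall j, 0 <= p j, 0 < p 0%N & psum p m @[m --> \oo] --> +oo].

Definition t11 (R : realType) (V : lmodType R) (p q : nat -> R)
    (x : nat -> nat -> V) (m n : nat) : V :=
  (psum p m * psum q n)^-1 *:
    \sum_(0 <= j < m.+1) \sum_(0 <= k < n.+1) (p j * q k) *: x j k.

Definition Npq11_summable (R : realType) (V : lmodType R)
    (mu nu : V -> R -> R) (p q : nat -> R) (x : nat -> nat -> V) (l : V) : Prop :=
  IF_dcvg mu nu (t11 p q x) l.

(* [Num.truncn] agrees with the integer part on nonnegative reals; only
   0 < lambda is used below. *)
Definition lam_idx (R : realType) (lambda : R) (m : nat) : nat :=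
  Num.truncn (lambda * m%:R).

(* The lower limit is extended-real: for lambda > 1 the ratio may be
   unbounded. *)
Definition SVA_plus (R : realType) (p : nat -> R) : Prop :=
  [/\ forall j, 0 <= p j, 0 < p 0%N &
    forall lambda : R, 0 < lambda -> lambda != 1 ->
      (0 < limn_einf (fun m : nat =>
             (`|psum p (lam_idx lambda m) / psum p m - 1|)%:E))%E].

(* For lambda > 1 and p, q in SVA_plus the denominator is positive for all large
   m, n; the value x^-1 = 0 at x = 0 only affects finitely many m or n, which the
   Pringsheim limits do not see. *)
Definition moving_diff (R : realType) (V : lmodType R) (p q : nat -> R)
    (x : nat -> nat -> V) (lambda : R) (m n : nat) : V :=
  ((psum p (lam_idx lambda m) - psum p m) *
   (psum q (lam_idx lambda n) - psum q n))^-1 *: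
    \sum_(m.+1 <= j < (lam_idx lambda m).+1)
      \sum_(n.+1 <= k < (lam_idx lambda n).+1)
        (p j * q k) *: (x j k - x m n).

(* Main.v *)
Require Import Defs.
From HB Require Import structures.
From mathcomp Require Import all_boot all_order all_algebra.
From mathcomp Require Import all_classical all_reals all_analysis.
From mathcomp Require Import ring lra.

(** Write [y m n = x m n - l] and let [T m n] be its weighted means over the
    rectangles with corner [(0, 0)], so that [T -> 0] by summability.  For
    [lambda > 1] and [m, n] large, the weighted average of [y] over the block
    [m < j <= lam m], [n < k <= lam n] can be computed in two ways.

    On the one hand it equals [y m n] plus the moving difference of the
    criterion.  On the other hand, by inclusion-exclusion, it is a combination
    of [T] at the four corners of the block, with coefficients that are
    products of [P_lam / (P_lam - P)] and [P / (P_lam - P)]; membership of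
    the weights in [SVA_plus] keeps these bounded, so the block average tends to 0
    ([block_average_null]).

    Hence [y m n] and minus the moving difference have the same asymptotic
    behaviour for each fixed [lambda]; in particular, if for each tolerance
    some [lambda] makes the moving difference eventually small, then [y] is
    eventually small ([tauberian]).  Conversely, if [y -> 0], all the terms
    [x j k - x m n] of the moving difference are small, and a weighted average
    of small vectors is small because [mu (_ + _, _ + _)] dominates a minimum
    ([fuzzy_average], [abelian]).

    The functions [mu] and [1 - nu] satisfy the same axioms, those of
    [fuzzy_seminorm], so the argument is run once for an abstract [N].  The
    suprema of lower limits and infima of upper limits are unfolded into
    statements about eventual bounds by [sup_dlim_infP] and [inf_dlim_supP]. *)

Set Implicit Arguments.
Unset Strict Implicit.
Unset Printing Implicit Defensive.

Import Order.TTheory GRing.Theory Num.Theory.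
Import numFieldNormedType.Exports.

Local Open Scope classical_set_scope.
Local Open Scope ring_scope.

(** * Eventual properties of double sequences *)

Definition eventually2 (P : nat -> nat -> Prop) : Prop :=
  exists N, forall m n, (N <= m)%N -> (N <= n)%N -> P m n.

Lemma eventually2_mono (P Q : nat -> nat -> Prop) :
  (forall m n, P m n -> Q m n) -> eventually2 P -> eventually2 Q.
Proof. by move=> PQ [N HN]; exists N => m n Nm Nn; apply/PQ/HN. Qed.

Lemma eventually2_and (P Q : nat -> nat -> Prop) :
  eventually2 P -> eventually2 Q -> eventually2 (fun m n => P m n /\ Q m n).
Proof.
move=> [N1 H1] [N2 H2]; exists (maxn N1 N2) => m n.
rewrite !geq_max => /andP[m1 m2] /andP[n1 n2].
by split; [apply: H1|apply: H2].
Qed.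

(** * Pringsheim limits in terms of eventual bounds *)

Section Pringsheim.
Variable R : realType.
Implicit Types a : nat -> nat -> R.

Let tail a N : set \bar R :=
  [set (a mn.1 mn.2)%:E | mn in [set mn | (N <= mn.1)%N /\ (N <= mn.2)%N]].

Let tail_sub a m n : (m <= n)%N -> tail a n `<=` tail a m.
Proof.
by move=> mn _ [k [k1 k2] <-]; exists k => //; split; apply: (leq_trans mn).
Qed.

Let tailP a N m n : (N <= m)%N -> (N <= n)%N -> tail a N (a m n)%:E.
Proof. by move=> Nm Nn; exists (m, n). Qed.

Lemma dlim_infE a :
  dlim_inf a = ereal_sup (range (fun N => ereal_inf (tail a N))).
Proof.
apply/cvg_lim => //; apply: ereal_nondecreasing_cvgn => m n mn.
exact/ereal_inf_le_tmp/tail_sub.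
Qed.

Lemma dlim_supE a :
  dlim_sup a = ereal_inf (range (fun N => ereal_sup (tail a N))).
Proof.
apply/cvg_lim => //; apply: ereal_nonincreasing_cvgn => m n mn.
exact/le_ereal_sup/tail_sub.
Qed.

Lemma sup_dlim_infP (L : set R) (a : R -> nat -> nat -> R) :
  (forall s m n, a s m n <= 1) ->
  ereal_sup [set dlim_inf (a s) | s in L] = 1%E <->
  forall b, b < 1 -> exists2 s, L s & eventually2 (fun m n => b < a s m n).
Proof.
move=> a1; split=> [sup1 b b1|H].
- have /ereal_sup_gt[_ [s Ls <-]] :
      (b%:E < ereal_sup [set dlim_inf (a s) | s in L])%E by rewrite sup1 lte_fin.
  rewrite dlim_infE => /ereal_sup_gt[_ [N _ <-]] bN.
  exists s => //; exists N => m n Nm Nn; rewrite -lte_fin.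
  exact/(lt_le_trans bN)/ereal_inf_lbound/tailP.
apply/eqP; rewrite eq_le; apply/andP; split.
- apply: ge_ereal_sup => _ [s Ls <-]; rewrite dlim_infE.
  apply: ge_ereal_sup => _ [N _ <-]; apply: ge_ereal_inf.
  by exists (a s N N)%:E; [exact: tailP|rewrite lee_fin].
apply/lee_subgt0Pr => e e0; have /H[s Ls [N HN]] : 1 - e < 1 by lra.
apply: (@le_trans _ _ (dlim_inf (a s))); last first.
  by apply: ereal_sup_ubound; exists s.
rewrite dlim_infE; apply: (@le_trans _ _ (ereal_inf (tail (a s) N))); last first.
  by apply: ereal_sup_ubound; exists N.
apply: le_ereal_inf_tmp => _ [[m n] /= [Nm Nn] <-].
by rewrite -EFinB lee_fin ltW// HN.
Qed.

(** The bound is phrased for [1 - a] because the dual fuzzy function enters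
    only through its complement. *)
Lemma inf_dlim_supP (L : set R) (a : R -> nat -> nat -> R) :
  (forall s m n, 0 <= a s m n) ->
  ereal_inf [set dlim_sup (a s) | s in L] = 0%E <->
  forall b, b < 1 -> exists2 s, L s & eventually2 (fun m n => b < 1 - a s m n).
Proof.
move=> a0; split=> [inf0 b b1|H].
- have /ereal_inf_lt[_ [s Ls <-]] :
      (ereal_inf [set dlim_sup (a s) | s in L] < (1 - b)%:E)%E.
    by rewrite inf0 lte_fin; lra.
  rewrite dlim_supE => /ereal_inf_lt[_ [N _ <-]] bN.
  exists s => //; exists N => m n Nm Nn.
  have : ((a s m n)%:E < (1 - b)%:E)%E.
    by apply: le_lt_trans bN; apply/ereal_sup_ubound/tailP.
  by rewrite lte_fin; lra.
apply/eqP; rewrite eq_le; apply/andP; split; last first.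
- apply: le_ereal_inf_tmp => _ [s Ls <-]; rewrite dlim_supE.
  apply: le_ereal_inf_tmp => _ [N _ <-].
  apply: (@le_trans _ _ (a s N N)%:E); first by rewrite lee_fin.
  exact/ereal_sup_ubound/tailP.
apply/lee_addgt0Pr => e e0; have /H[s Ls [N HN]] : 1 - e < 1 by lra.
apply: ge_ereal_inf; exists (dlim_sup (a s)); first by exists s.
rewrite dlim_supE; apply: ge_ereal_inf.
exists (ereal_sup (tail (a s) N)); first by exists N.
apply: ge_ereal_sup => _ [[m n] /= [Nm Nn] <-].
by rewrite add0e lee_fin; have := HN m n Nm Nn; lra.
Qed.

End Pringsheim.

(** * The common axioms of [mu] and [1 - nu] *)

Record fuzzy_seminorm (R : realType) (V : lmodType R) (N : V -> R -> R) : Prop :=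
  FuzzySeminorm {
    fuzzy_le1 : forall v t, N v t <= 1;
    fuzzy_0 : forall t, 0 < t -> N 0 t = 1;
    fuzzy_Z : forall v t c, 0 < t -> c != 0 -> N (c *: v) t = N v (t / `|c|);
    fuzzy_D : forall v w t s, Num.min (N v t) (N w s) <= N (v + w) (t + s)
  }.

Lemma IF_norm_mu (R : realType) (V : lmodType R) (mu nu : V -> R -> R) :
  IF_norm mu nu -> fuzzy_seminorm mu.
Proof.
move=> h; split=> [v t|t t0|v t c|v w t s].
- by case/andP: (mu_range h v t).
- by have [_ ->] := mu_eq1 h 0.
- exact: mu_scale h v t c.
- exact: mu_add h v w t s.
Qed.

Lemma IF_norm_nu (R : realType) (V : lmodType R) (mu nu : V -> R -> R) :
  IF_norm mu nu -> fuzzy_seminorm (fun v t => 1 - nu v t).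
Proof.
move=> h; split=> [v t|t t0|v t c t0 c0|v w t s].
- by case/andP: (nu_range h v t) => + _; lra.
- by have [_ ->] := nu_eq0 h 0; rewrite ?subr0.
- by rewrite (nu_scale h).
- have := nu_add h v w t s; rewrite le_max ge_min => /orP[] H.
    by apply/orP; left; lra.
  by apply/orP; right; lra.
Qed.

Section FuzzySeminorm.
Variables (R : realType) (V : lmodType R) (N : V -> R -> R).
Hypothesis hN : fuzzy_seminorm N.
Implicit Types u v : nat -> nat -> V.

Lemma fuzzyD_gt b (v w : V) t s :
  b < N v t -> b < N w s -> b < N (v + w) (t + s).
Proof.
by move=> bv bw; apply: lt_le_trans (fuzzy_D hN v w t s); rewrite lt_min bv.
Qed.

Lemma fuzzy_homo (v : V) t s : t <= s -> N v t <= N v s.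
Proof.
rewrite le_eqVlt => /predU1P[->//|ts].
have := fuzzy_D hN v 0 t (s - t); rewrite addr0 [t + _]addrC subrK.
rewrite (fuzzy_0 hN) ?subr_gt0//; apply: le_trans.
by rewrite le_min lexx (fuzzy_le1 hN).
Qed.

Lemma fuzzy_Z_ge (v : V) c C t :
  0 < C -> `|c| <= C -> 0 < t -> N v (t / C) <= N (c *: v) t.
Proof.
move=> C0 cC t0; have [->|c0] := eqVneq c 0.
  by rewrite scale0r (fuzzy_0 hN)// (fuzzy_le1 hN).
rewrite (fuzzy_Z hN)//; apply: fuzzy_homo.
by rewrite ler_pM2l// lef_pV2 ?posrE ?normr_gt0.
Qed.

(** The slack [s] makes terms of weight 0 harmless: [N] carries no
    information at [t = 0], so a zero vector costs an arbitrarily small but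
    positive amount. *)
Lemma fuzzy_sum (I : eqType) (r : seq I) (c : I -> R) (v : I -> V) b t s :
  (forall i, 0 <= c i) -> b < 1 -> 0 < t -> 0 < s ->
  (forall i, i \in r -> b < N (v i) t) ->
  b < N (\sum_(i <- r) c i *: v i) ((\sum_(i <- r) c i) * t + s).
Proof.
move=> c0 b1 t0 s0; elim: r => [|i r IH] H.
  by rewrite !big_nil mul0r add0r (fuzzy_0 hN).
have {}IH : b < N (\sum_(i <- r) c i *: v i) ((\sum_(i <- r) c i) * t + s).
  by apply: IH => j jr; apply: H; rewrite inE jr orbT.
rewrite !big_cons; have [ci0|ci0] := eqVneq (c i) 0.
  by rewrite ci0 scale0r !add0r.
have cp : 0 < c i by rewrite lt_neqAle eq_sym ci0 c0.
rewrite mulrDl -addrA; apply: fuzzyD_gt => //.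
rewrite (fuzzy_Z hN) ?mulr_gt0// gtr0_norm// mulrAC divff// mul1r.
by apply: H; rewrite mem_head.
Qed.

(** Weights on a product are handled by summing one index at a time: the inner
    sums are again vectors satisfying a lower bound, at a rescaled time. *)
Lemma fuzzy_average (I J : eqType) (r : seq I) (r' : seq J)
    (c : I -> R) (d : J -> R) (v : I -> J -> V) b t :
  (forall i, 0 <= c i) -> (forall j, 0 <= d j) -> b < 1 -> 0 < t ->
  (forall i j, i \in r -> j \in r' -> b < N (v i j) (t / 2)) ->
  b < N (((\sum_(i <- r) c i) * (\sum_(j <- r') d j))^-1 *:
           \sum_(i <- r) \sum_(j <- r') (c i * d j) *: v i j) t.
Proof.
move=> c0 d0 b1 t0 H; set C := \sum_(i <- r) c i; set D := \sum_(j <- r') d j.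
have C0 : 0 <= C by apply: sumr_ge0.
have D0 : 0 <= D by apply: sumr_ge0.
have [CD0|CD0] := eqVneq (C * D) 0.
  by rewrite CD0 invr0 scale0r (fuzzy_0 hN).
have CDp : 0 < C * D by rewrite lt_neqAle eq_sym CD0 mulr_ge0.
have Cp : 0 < C by rewrite lt_neqAle C0 andbT; apply: contraNneq CD0 => <-; rewrite mul0r.
have Dp : 0 < D by rewrite lt_neqAle D0 andbT; apply: contraNneq CD0 => <-; rewrite mulr0.
rewrite (fuzzy_Z hN) ?invr_neq0// gtr0_norm ?invr_gt0// invrK.
under eq_bigr do under eq_bigr do rewrite -scalerA.
under eq_bigr do rewrite -scaler_sumr.
(* Half of the available time pays for the terms, a quarter for the slack of
   each of the two summations. *)
have -> : t * (C * D) = C * (D * (t / 2) + D * t / 4) + C * D * t / 4 by field.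
have Dt : 0 < D * t by rewrite mulr_gt0.
have CDt : 0 < C * D * t by rewrite mulr_gt0.
apply: fuzzy_sum => //; [by lra|by lra|].
move=> i ir; apply: fuzzy_sum => //; [by lra|by lra|].
by move=> j jr; apply: H.
Qed.

(** * Null double sequences *)

Definition null2 u : Prop :=
  forall t b, 0 < t -> b < 1 -> eventually2 (fun m n => b < N (u m n) t).

Lemma null2_ext u v :
  eventually2 (fun m n => u m n = v m n) -> null2 u -> null2 v.
Proof.
move=> uv hu t b t0 b1; apply: eventually2_mono (eventually2_and uv (hu t b t0 b1)).
by move=> m n [->].
Qed.

Lemma null2D u v : null2 u -> null2 v -> null2 (fun m n => u m n + v m n).
Proof.
move=> hu hv t b t0 b1; have t2 : 0 < t / 2 by lra.
apply: eventually2_mono (eventually2_and (hu _ _ t2 b1) (hv _ _ t2 b1)).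
by move=> m n []; rewrite {3}(splitr t); apply: fuzzyD_gt.
Qed.

Lemma null2Z (c : nat -> nat -> R) C u :
  eventually2 (fun m n => `|c m n| <= C) -> null2 u ->
  null2 (fun m n => c m n *: u m n).
Proof.
move=> cC hu t b t0 b1; have C0 : 0 < `|C| + 1 by rewrite ltr_wpDl.
have tC : 0 < t / (`|C| + 1) by rewrite divr_gt0.
apply: eventually2_mono (eventually2_and cC (hu _ _ tC b1)) => m n [cmn H].
apply: (lt_le_trans H); apply: fuzzy_Z_ge => //.
by apply: (le_trans cmn); have := ler_norm C; lra.
Qed.

Lemma null2_reindex u (f g : nat -> nat) :
  (forall m, (m <= f m)%N) -> (forall n, (n <= g n)%N) ->
  null2 u -> null2 (fun m n => u (f m) (g n)).
Proof.
move=> hf hg hu t b t0 b1; have [K HK] := hu t b t0 b1.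
by exists K => m n Km Kn; apply: HK; [exact: leq_trans (hf m)|exact: leq_trans (hg n)].
Qed.

End FuzzySeminorm.

(** * Rectangular sums, weighted means and moving differences *)

Section Means.
Variables (R : realType) (V : lmodType R).
Implicit Types (x y : nat -> nat -> V) (p q : nat -> R).

Lemma big_nat_diff (f : nat -> V) m M : (m <= M)%N ->
  \sum_(m.+1 <= j < M.+1) f j =
  \sum_(0 <= j < M.+1) f j - \sum_(0 <= j < m.+1) f j.
Proof.
by move=> mM; rewrite (@big_cat_nat _ _ _ m.+1 0 M.+1)//= addrAC subrr add0r.
Qed.

Lemma psum_diff p m M : (m <= M)%N ->
  \sum_(m.+1 <= j < M.+1) p j = psum p M - psum p m.
Proof.
by move=> mM; rewrite /psum (@big_cat_nat _ _ _ m.+1 0 M.+1)//= addrAC subrr add0r.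
Qed.

Lemma block_sum (f : nat -> nat -> V) m M n K : (m <= M)%N -> (n <= K)%N ->
  let S a b := \sum_(0 <= j < a.+1) \sum_(0 <= k < b.+1) f j k in
  \sum_(m.+1 <= j < M.+1) \sum_(n.+1 <= k < K.+1) f j k =
  S M K - S M n - (S m K - S m n).
Proof.
move=> mM nK /=; under eq_bigr do rewrite big_nat_diff//.
by rewrite big_nat_diff// !sumrB.
Qed.

Lemma psum_gt0 p m : weights p -> 0 < psum p m.
Proof.
move=> [p0 p00 _]; rewrite /psum big_nat_recl//.
by rewrite ltr_wpDr// sumr_ge0.
Qed.

Lemma lam_idx_ge (lambda : R) m : 1 < lambda -> (m <= lam_idx lambda m)%N.
Proof.
move=> l1; have l0 : 0 <= lambda by lra.
by rewrite /lam_idx truncn_ge_nat ?mulr_ge0// ler_peMl// ltW.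
Qed.

Lemma t11_translate p q x l m n : weights p -> weights q ->
  t11 p q (fun j k => x j k - l) m n = t11 p q x m n - l.
Proof.
move=> hp hq; have P0 := psum_gt0 m hp; have Q0 := psum_gt0 n hq.
rewrite /t11; under eq_bigr do (under eq_bigr do rewrite scalerBr; rewrite sumrB).
rewrite sumrB scalerBr; congr (_ - _).
under eq_bigr do (rewrite -scaler_suml -mulr_sumr).
by rewrite -scaler_suml -mulr_suml scalerA mulVf ?scale1r// mulf_neq0 ?gt_eqF.
Qed.

Lemma moving_diff_translate p q x l lambda m n :
  moving_diff p q (fun j k => x j k - l) lambda m n = moving_diff p q x lambda m n.
Proof.
rewrite /moving_diff; congr (_ *: _); apply: eq_bigr => j _; apply: eq_bigr => k _.
by congr (_ *: _); rewrite opprB addrA subrK.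
Qed.

Definition block_average p q y (lambda : R) m n : V :=
  ((psum p (lam_idx lambda m) - psum p m) *
   (psum q (lam_idx lambda n) - psum q n))^-1 *:
    \sum_(m.+1 <= j < (lam_idx lambda m).+1)
      \sum_(n.+1 <= k < (lam_idx lambda n).+1) (p j * q k) *: y j k.

(** The subtracted terms of the moving difference are all [y m n], and the
    weights of the block have total mass 1 once normalised. *)
Lemma block_average_moving_diff p q y lambda m n : 1 < lambda ->
  psum p (lam_idx lambda m) != psum p m ->
  psum q (lam_idx lambda n) != psum q n ->
  y m n = block_average p q y lambda m n - moving_diff p q y lambda m n.
Proof.
move=> l1; rewrite -subr_eq0 => P0; rewrite -subr_eq0 => Q0.
rewrite /block_average /moving_diff -scalerBr -sumrB.
under eq_bigr do rewrite -sumrB.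
under eq_bigr do under eq_bigr do rewrite -scalerBr subKr.
under eq_bigr do (rewrite -scaler_suml -mulr_sumr).
rewrite -scaler_suml -mulr_suml scalerA !psum_diff ?lam_idx_ge//.
by rewrite mulVf ?scale1r// mulf_neq0.
Qed.

Definition outer_ratio p (lambda : R) m : R :=
  psum p (lam_idx lambda m) / (psum p (lam_idx lambda m) - psum p m).

Definition inner_ratio p (lambda : R) m : R :=
  psum p m / (psum p (lam_idx lambda m) - psum p m).

(** Inclusion-exclusion on rectangular sums anchored at [(0, 0)]; the ratios
    convert the normalisation at each corner into that of the block. *)
Lemma block_average_corners p q y lambda m n : 1 < lambda ->
  weights p -> weights q ->
  psum p (lam_idx lambda m) != psum p m ->
  psum q (lam_idx lambda n) != psum q n ->
  block_average p q y lambda m n =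
    (outer_ratio p lambda m * outer_ratio q lambda n) *:
      t11 p q y (lam_idx lambda m) (lam_idx lambda n)
  + - (outer_ratio p lambda m * inner_ratio q lambda n) *:
      t11 p q y (lam_idx lambda m) n
  + (- (inner_ratio p lambda m * outer_ratio q lambda n) *:
      t11 p q y m (lam_idx lambda n)
  + (inner_ratio p lambda m * inner_ratio q lambda n) *: t11 p q y m n).
Proof.
move=> l1 hp hq; rewrite -subr_eq0 => DP; rewrite -subr_eq0 => DQ; move: DP DQ.
rewrite /block_average /outer_ratio /inner_ratio /t11 !scalerA.
rewrite block_sum ?lam_idx_ge//=.
have := psum_gt0 m hp; have := psum_gt0 (lam_idx lambda m) hp.
have := psum_gt0 n hq; have := psum_gt0 (lam_idx lambda n) hq.
move: (psum p m) (psum p (lam_idx _ _)) (psum q n) (psum q (lam_idx _ _)).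
move=> P P' Q Q' /lt0r_neq0 Q'0 /lt0r_neq0 Q0 /lt0r_neq0 P'0 /lt0r_neq0 P0 DP DQ.
have E a b : a != 0 -> b != 0 ->
    a / (P' - P) * (b / (Q' - Q)) * (a * b)^-1 = ((P' - P) * (Q' - Q))^-1.
  by move=> a0 b0; field; rewrite a0 b0 DP DQ.
rewrite !mulNr !E// opprB addrA !scaleNr.
by rewrite !scalerDr !scalerN -!addrA; congr (_ + (_ + _)); rewrite addrC.
Qed.

(** For [lambda > 1] the absolute value in the definition of [SVA_plus] is the
    reciprocal of the inner ratio, and the outer ratio is 1 plus the inner
    one. *)
Lemma SVA_plus_ratio_bounded p lambda : weights p -> SVA_plus p -> 1 < lambda ->
  exists C, exists K, forall m, (K <= m)%N ->
    [/\ psum p (lam_idx lambda m) != psum p m,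
        0 <= outer_ratio p lambda m <= C & 0 <= inner_ratio p lambda m <= C].
Proof.
move=> hp [_ _ hS] l1.
have l0 : 0 < lambda by lra.
have {hS} : (0 < limn_einf (fun m : nat =>
    (`|psum p (lam_idx lambda m) / psum p m - 1|)%:E))%E.
  by apply: hS => //; rewrite gt_eqF.
rewrite limn_einf_lim (cvg_lim _ (@cvg_einfs_sup _ _))//.
move=> /ereal_sup_gt[_ [K _ <-]]; set u := (X in einfs X) => c0.
have cu m : (K <= m)%N -> (einfs u K <= u m)%E.
  by move=> Km; apply: ereal_inf_lbound; exists m.
have cfin : einfs u K \is a fin_num.
  by rewrite ge0_fin_numE ?ltW//; apply: le_lt_trans (cu K _) (ltry _).
move: c0 cu; rewrite -(fineK cfin); move: (fine _) => d.
rewrite lte_fin => d0 cu; exists (1 + d^-1), K => m /cu.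
rewrite /u lee_fin /outer_ratio /inner_ratio.
have P0 := psum_gt0 m hp.
have PP' : psum p m <= psum p (lam_idx lambda m).
  rewrite -subr_ge0 -psum_diff ?lam_idx_ge//.
  by apply: sumr_ge0 => j _; case: hp.
move: (psum p m) (psum p (lam_idx _ _)) P0 PP' => P P' P0 PP'.
rewrite ger0_norm; last by rewrite subr_ge0 ler_pdivlMr// mul1r.
move=> dP.
have DP : d * P <= P' - P.
  by have := ler_wpM2r (ltW P0) dP; rewrite mulrBl mul1r divfK ?gt_eqF.
have D0 : 0 < P' - P by apply: lt_le_trans DP; rewrite mulr_gt0.
have H : P / (P' - P) <= d^-1.
  by rewrite ler_pdivrMr// -ler_pdivrMl ?invr_gt0// invrK.
have H' : P' / (P' - P) = 1 + P / (P' - P) by field; rewrite gt_eqF.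
have H0 : 0 <= P / (P' - P) by rewrite divr_ge0// ltW.
by rewrite H'; split; [rewrite -subr_eq0 gt_eqF|apply/andP; split; lra..].
Qed.

End Means.

(** * The two implications, for one fuzzy seminorm *)

Section Tauberian.
Variables (R : realType) (V : lmodType R) (N : V -> R -> R).
Hypothesis hN : fuzzy_seminorm N.
Variables p q : nat -> R.
Hypotheses (hp : weights p) (hq : weights q).
Implicit Types y : nat -> nat -> V.

Lemma abelian y lambda : 1 < lambda ->
  null2 N y -> null2 N (moving_diff p q y lambda).
Proof.
move=> l1 hy t b t0 b1; have t4 : 0 < t / 2 / 2 by lra.
have [K HK] := hy _ _ t4 b1; exists K => m n Km Kn.
rewrite /moving_diff -!psum_diff ?lam_idx_ge//.
apply: (fuzzy_average hN) => //; [by case: hp|by case: hq|].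
move=> j k; rewrite !mem_index_iota => /andP[mj _] /andP[nk _].
rewrite (splitr (t / 2)); apply: (fuzzyD_gt hN).
  by apply: HK; [exact: leq_trans (ltnW mj)|exact: leq_trans (ltnW nk)].
by rewrite -scaleN1r (fuzzy_Z hN)// ?oppr_eq0 ?oner_eq0// normrN1 divr1 HK.
Qed.

Hypotheses (hpS : SVA_plus p) (hqS : SVA_plus q).

Lemma block_average_null y lambda : 1 < lambda ->
  null2 N (t11 p q y) -> null2 N (block_average p q y lambda).
Proof.
move=> l1 hT.
have [C [K HK]] := SVA_plus_ratio_bounded hp hpS l1.
have [D [L HL]] := SVA_plus_ratio_bounded hq hqS l1.
have bnd (a b : nat -> R) : (forall m, (K <= m)%N -> 0 <= a m <= C) ->
    (forall n, (L <= n)%N -> 0 <= b n <= D) ->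
    eventually2 (fun m n => `|a m * b n| <= C * D).
  move=> ha hb; exists (maxn K L) => m n.
  rewrite !geq_max => /andP[/ha/andP[a0 aC] _] /andP[_ /hb/andP[b0 bD]].
  by rewrite ger0_norm ?mulr_ge0// ler_pM.
have bndN (a b : nat -> R) : (forall m, (K <= m)%N -> 0 <= a m <= C) ->
    (forall n, (L <= n)%N -> 0 <= b n <= D) ->
    eventually2 (fun m n => `|- (a m * b n)| <= C * D).
  by move=> ha hb; apply: eventually2_mono (bnd a b ha hb) => m n; rewrite normrN.
have oC m : (K <= m)%N -> 0 <= outer_ratio p lambda m <= C by case/HK.
have iC m : (K <= m)%N -> 0 <= inner_ratio p lambda m <= C by case/HK.
have oD n : (L <= n)%N -> 0 <= outer_ratio q lambda n <= D by case/HL.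
have iD n : (L <= n)%N -> 0 <= inner_ratio q lambda n <= D by case/HL.
have lam m : (m <= lam_idx lambda m)%N by apply: lam_idx_ge.
have c1 := null2Z hN (bnd _ _ oC oD) (null2_reindex lam lam hT).
have c2 := null2Z hN (bndN _ _ oC iD) (null2_reindex lam (@leqnn) hT).
have c3 := null2Z hN (bndN _ _ iC oD) (null2_reindex (@leqnn) lam hT).
have c4 := null2Z hN (bnd _ _ iC iD) hT.
apply: null2_ext (null2D hN (null2D hN c1 c2) (null2D hN c3 c4)).
exists (maxn K L) => m n; rewrite !geq_max => /andP[/HK[P0 _ _] _] /andP[_ /HL[Q0 _ _]].
by rewrite block_average_corners.
Qed.

Lemma tauberian y : null2 N (t11 p q y) ->
  (forall t b, 0 < t -> b < 1 -> exists2 lambda, 1 < lambda &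
    eventually2 (fun m n => b < N (moving_diff p q y lambda m n) t)) ->
  null2 N y.
Proof.
move=> hT H t b t0 b1; have t2 : 0 < t / 2 by lra.
have [lambda l1 ev] := H _ _ t2 b1.
have [C [K HK]] := SVA_plus_ratio_bounded hp hpS l1.
have [D [L HL]] := SVA_plus_ratio_bounded hq hqS l1.
have ne : eventually2 (fun m n => psum p (lam_idx lambda m) != psum p m /\
                                  psum q (lam_idx lambda n) != psum q n).
  exists (maxn K L) => m n; rewrite !geq_max.
  by move=> /andP[/HK[P0 _ _] _] /andP[_ /HL[Q0 _ _]].
have avg := block_average_null l1 hT t2 b1.
apply: eventually2_mono (eventually2_and ne (eventually2_and avg ev)).
move=> m n [[P0 Q0] [Ha Hm]].
rewrite (block_average_moving_diff y l1 P0 Q0) (splitr t).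
apply: (fuzzyD_gt hN) => //.
by rewrite -scaleN1r (fuzzy_Z hN)// ?oppr_eq0 ?oner_eq0// normrN1 divr1.
Qed.

Lemma null2_iff_moving_diff y : null2 N (t11 p q y) ->
  null2 N y <->
  (forall t b, 0 < t -> b < 1 -> exists2 lambda, 1 < lambda &
    eventually2 (fun m n => b < N (moving_diff p q y lambda m n) t)).
Proof.
move=> hT; split=> [hy t b t0 b1|]; last exact: tauberian.
have l2 : (1 : R) < 2 by lra.
by exists 2 => //; apply: abelian.
Qed.

End Tauberian.

Lemma IF_dcvg_null2 (R : realType) (V : lmodType R) (mu nu : V -> R -> R)
    (x : nat -> nat -> V) (l : V) :
  IF_dcvg mu nu x l <->
  null2 mu (fun m n => x m n - l) /\
  null2 (fun v t => 1 - nu v t) (fun m n => x m n - l).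
Proof.
split=> [H|[Hmu Hnu] t e t0 /andP[e0 e1]].
  (* Only thresholds below 1 are informative, but [b] may be negative. *)
  have K t b : 0 < t -> b < 1 -> eventually2 (fun m n =>
      b < mu (x m n - l) t /\ b < 1 - nu (x m n - l) t).
    move=> t0 b1; have e01 : 0 < Num.min (1 - b) (1 / 2 : R) < 1.
      by rewrite lt_min gt_min; apply/andP; split; [apply/andP; split|apply/orP; right]; lra.
    apply: eventually2_mono (H t _ t0 e01) => m n.
    have : Num.min (1 - b) (1 / 2 : R) <= 1 - b by rewrite ge_min lexx.
    by move: (Num.min _ _) => e eb [h1 h2]; split; lra.
  by split=> t b t0 b1; apply: eventually2_mono (K t b t0 b1) => m n [].
have e1' : 1 - e < 1 by lra.
apply: eventually2_mono (eventually2_and (Hmu _ _ t0 e1') (Hnu _ _ t0 e1')).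
by move=> m n [h1 h2]; split=> //; lra.
Qed.

Theorem theorem9 (R : realType) (V : lmodType R) (mu nu : V -> R -> R)
    (hV : IF_norm mu nu) (p q : nat -> R)
    (hp : weights p) (hq : weights q)
    (hpS : SVA_plus p) (hqS : SVA_plus q)
    (x : nat -> nat -> V) (l : V)
    (hx : Npq11_summable mu nu p q x l) :
  IF_dcvg mu nu x l <->
  (forall t : R, 0 < t ->
    ereal_sup [set dlim_inf (fun m n => mu (moving_diff p q x lambda m n) t)
              | lambda in [set lambda : R | 1 < lambda]] = 1%E /\
    ereal_inf [set dlim_sup (fun m n => nu (moving_diff p q x lambda m n) t)
              | lambda in [set lambda : R | 1 < lambda]] = 0%E).
Proof.
pose y m n := x m n - l.
have mdE lambda m n : moving_diff p q x lambda m n = moving_diff p q y lambda m n.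
  by rewrite moving_diff_translate.
have tE m n : t11 p q x m n - l = t11 p q y m n by rewrite t11_translate.
have hT (N : V -> R -> R) :
    null2 N (fun m n => t11 p q x m n - l) -> null2 N (t11 p q y).
  by apply: null2_ext; exists 0%N.
have [/hT hTmu /hT hTnu] := (IF_dcvg_null2 mu nu (t11 p q x) l).1 hx.
have hmu := null2_iff_moving_diff (IF_norm_mu hV) hp hq hpS hqS hTmu.
have hnu := null2_iff_moving_diff (IF_norm_nu hV) hp hq hpS hqS hTnu.
have mu1 t (lambda : R) m n : mu (moving_diff p q x lambda m n) t <= 1.
  by case/andP: (mu_range hV (moving_diff p q x lambda m n) t).
have nu0 t (lambda : R) m n : 0 <= nu (moving_diff p q x lambda m n) t.
  by case/andP: (nu_range hV (moving_diff p q x lambda m n) t).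
split=> [/IF_dcvg_null2[/hmu Hmu /hnu Hnu] t t0|H].
- split.
    apply/(sup_dlim_infP _ (mu1 t)) => b b1; have [lambda l1 ev] := Hmu t b t0 b1.
    by exists lambda => //; apply: eventually2_mono ev => m n; rewrite mdE.
  apply/(inf_dlim_supP _ (nu0 t)) => b b1; have [lambda l1 ev] := Hnu t b t0 b1.
  by exists lambda => //; apply: eventually2_mono ev => m n; rewrite mdE.
apply/IF_dcvg_null2; split; [apply/hmu|apply/hnu] => t b t0 b1.
- have [/(sup_dlim_infP _ (mu1 t)) Hmu _] := H t t0.
  have [lambda l1 ev] := Hmu b b1; exists lambda => //.
  by apply: eventually2_mono ev => m n; rewrite mdE.
- have [_ /(inf_dlim_supP _ (nu0 t)) Hnu] := H t t0.
  have [lambda l1 ev] := Hnu b b1; exists lambda => //.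
  by apply: eventually2_mono ev => m n; rewrite mdE.
Qed.
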